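(* Let $P$ be a countable meet-continuous dcpo with binary meets. For each nonprincipal ideal $J$ of $P$, there exist $s<t\le\bigvee J$ in $P$ such that $[s,t)$ is directed and \[ \mathord{\downarrow}[s,t)\subseteq J,\qquad \bigvee[s,t)=t\notin J. \]
   Context: All posets and directed sets are nonempty; countable sets may be finite. A subset $D$ of a poset is directed if any two of its elements have a common upper bound in $D$. A dcpo is a poset in which every directed subset has a supremum. Write $\mathord{\downarrow}x=\{y:y\le x\}$ and $\mathord{\downarrow}A=\bigcup_{a\in A}\mathord{\downarrow}a$. An ideal is a directed lower set; it is principal if it has the form $\mathord{\downarrow}x$. For $s<t$, $[s,t)=\{x:s\le x<t\}$. An upper set $U\subseteq P$ is Scott open if for every directed $D\subseteq P$, $\bigvee D\in U$ implies $D\cap U\neq\emptyset$; the Scott open sets form the Scott topology $\sigma(P)$. A dcpo $P$ is meet-continuous if for every $x\in P$ and every directed $D\subseteq P$, $x\le\bigvee D$ implies $x\in\operatorname{cl}_{\sigma(P)}(\mathord{\downarrow}x\cap\mathord{\downarrow}D)$, where $\operatorname{cl}_{\sigma(P)}$ is closure in the Scott topology. ''With binary meets'' means any two elements of $P$ have a greatest lower bound in $P$. *)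

(* Defs.v *)
From HB Require Import structures.
From mathcomp Require Import all_boot all_order.
From mathcomp Require Import boolp classical_sets topology_structure.

Set Implicit Arguments.
Unset Strict Implicit.
Unset Printing Implicit Defensive.

Import Order.TTheory.
Local Open Scope classical_set_scope.
Local Open Scope order_scope.

Section Poset.
Context {d : Order.disp_t} {P : porderType d}.
Implicit Types (x y s : P) (A D J U : set P).

Definition directed D : Prop :=
  D !=set0 /\
  forall x y, D x -> D y -> exists z, [/\ D z, x <= z & y <= z].

Definition down1 x : set P := [set y | y <= x].

Definition lower_set A : Prop := forall x y, A x -> y <= x -> A y.

Definition upper_set A : Prop := forall x y, A x -> x <= y -> A y.

Definition ideal J : Prop := directed J /\ lower_set J.

Definition principal J : Prop := exists x, J = down1 x.

Definition scott_open U : Prop :=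
  upper_set U /\
  forall D s, directed D -> supremums D s -> U s -> D `&` U !=set0.

Lemma scott_openT : scott_open setT.
Proof. by split=> // D s [[x Dx] _] _ _; exists x. Qed.

Lemma scott_openI U V : scott_open U -> scott_open V -> scott_open (U `&` V).
Proof.
move=> [uU oU] [uV oV]; split=> [x y [Ux Vx] xy|D s dD sD [Us Vs]].
  by split; [exact: uU xy | exact: uV xy].
have [a [Da Ua]] := oU D s dD sD Us; have [b [Db Vb]] := oV D s dD sD Vs.
have [c [Dc ac bc]] := dD.2 a b Da Db.
by exists c; split=> //; split; [exact: uU ac | exact: uV bc].
Qed.

Lemma scott_open_bigU (I : Type) (F : I -> set P) :
  (forall i, scott_open (F i)) -> scott_open (\bigcup_i F i).
Proof.
move=> oF; split=> [x y [i _ Fx] xy|D s dD sD [i _ Fs]].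
  by exists i => //; exact: (oF i).1 xy.
have [a [Da Fa]] := (oF i).2 D s dD sD Fs.
by exists a; split=> //; exists i.
Qed.

End Poset.

(* An alias of [P] carrying the Scott topology. *)
Definition scott {d : Order.disp_t} (P : porderType d) : Type := P.

HB.instance Definition _ (d : Order.disp_t) (P : porderType d) :=
  Choice.copy (scott P) P.

HB.instance Definition _ (d : Order.disp_t) (P : porderType d) :=
  @isOpenTopological.Build (scott P) (@scott_open d P)
    scott_openT scott_openI scott_open_bigU.

(* The library's [open] (hence [closure]) on [scott P] is Scott openness. *)
Lemma open_scottE (d : Order.disp_t) (P : porderType d) (U : set (scott P)) :
  open U = @scott_open d P U.
Proof. by []. Qed.

Definition dcpo {d : Order.disp_t} (P : porderType d) : Prop :=
  [set: P] !=set0 /\ forall D : set P, directed D -> supremums D !=set0.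

Definition meet_continuous {d : Order.disp_t} (P : porderType d) : Prop :=
  forall (x : P) (D : set P) (s : P), directed D -> supremums D s -> x <= s ->
    closure (down1 x `&` down D : set (scott P)) x.

(* Main.v *)
(* Write v for the supremum of J.  It suffices to find s in J and a minimal
   element t of [s, v] \ J: by meet-continuity every t <= v is the supremum of
   its lower bounds in J, and [s, t[ is the part of these above s.  If there
   were no such s and t, any interval [s, t] with s in J, t <= v and t not in J
   could be shrunk to one of the same kind avoiding a prescribed p: lower t
   strictly below p if p is not in J, and raise s to an element of J not below p
   otherwise.  Running through an enumeration of P, the supremum of the
   increasing lower endpoints lies in all the intervals, hence is no element
   of P. *)
Require Import Defs.
From HB Require Import structures.
From mathcomp Require Import all_boot all_order interval.
From mathcomp Require Import boolp classical_sets cardinality.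
From mathcomp Require Import topology_structure.

Import Order.TTheory.

Local Open Scope classical_set_scope.
Local Open Scope order_scope.

(** Principal ideals are Scott closed: if every element of a directed set is below [u], so is its
    supremum. *)
Lemma ub_scott_closure (d : Order.disp_t) (P : porderType d) (A : set P)
    (x u : P) :
  closure (A : set (scott P)) x -> ubound A u -> x <= u.
Proof.
move=> clAx ubAu; apply: contrapT => nxu.
have oU : scott_open (~` [set y : P | y <= u]).
  split=> [y z nyu yz zu|D s dD [_ lubDs] nsu].
    by apply: nyu; exact: le_trans yz zu.
  apply: contrapT => DU0; apply: nsu; apply: lubDs => y Dy.
  by apply: contrapT => nyu; apply: DU0; exists y.
have [|y [Ay nyu]] := clAx (~` [set y : P | y <= u]).
  by apply: open_nbhs_nbhs; split=> //; rewrite open_scottE.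
by apply: nyu; exact: ubAu.
Qed.

(** Meeting an upper bound taken in [J] with [t] keeps it in the lower set [J] and brings it below
    [t]. *)
Lemma directed_ideal_below (d : Order.disp_t) (P : meetSemilatticeType d)
    (J : set P) (s t : P) :
  ideal J -> J s -> s <= t -> directed (J `&` [set x | s <= x <= t]).
Proof.
move=> [[_ dirJ] lowJ] Js st; split; first by exists s; rewrite /= lexx st.
move=> x y [Jx /andP[sx xt]] [Jy /andP[sy yt]].
have [z [Jz xz yz]] := dirJ x y Jx Jy.
exists (z `&` t); split; rewrite ?lexI ?xz ?yz //=.
split; first by apply: lowJ Jz _; exact: leIl.
by rewrite leIr lexI (le_trans sx xz) st.
Qed.

Lemma sup_ideal_below (d : Order.disp_t) (P : meetSemilatticeType d)
    (J : set P) (v s t : P) :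
  meet_continuous P -> ideal J -> supremums J v -> J s -> s <= t -> t <= v ->
  supremums (J `&` [set x | s <= x <= t]) t.
Proof.
move=> mcP idJ supJ Js st tv; split=> [x [_ /andP[]]//|u ubu].
apply: (ub_scott_closure _ _ _ _ _ (mcP t J v idJ.1 supJ tv)).
move=> x [xt [y [Jy xy]]].
(* Choosing [z] above [s] as well puts the meet of [z] and [t] in the interval, still above [x]. *)
have [z [Jz yz sz]] := idJ.1.2 y s Jy Js.
apply: (@le_trans _ _ (z `&` t)); first by rewrite lexI xt (le_trans xy yz).
apply: ubu; split; first by apply: idJ.2 Jz _; exact: leIl.
by rewrite /= leIr lexI sz st.
Qed.

Lemma nested_intervals_dcpo (d : Order.disp_t) (P : porderType d)
    (s t : nat -> P) :
  dcpo P -> {homo s : m n / (m <= n)%N >-> m <= n} ->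
  {homo t : m n / (m <= n)%N >-> n <= m} -> (forall n, s n <= t n) ->
  exists x, forall n, s n <= x <= t n.
Proof.
move=> [_ supP] s_mono t_mono st.
have [|x [ubx lubx]] := supP (range s).
  split; first by exists (s 0%N), 0%N.
  move=> _ _ [m _ <-] [n _ <-]; exists (s (maxn m n)).
  by split; [exists (maxn m n) | apply: s_mono; exact: leq_maxl
                               | apply: s_mono; exact: leq_maxr].
exists x => n; apply/andP; split; first by apply: ubx; exists n.
apply: lubx => _ [m _ <-].
(* With [k = maxn m n]: [s m <= s k <= t k <= t n]. *)
apply: (le_trans (s_mono _ _ (leq_maxl m n))).
by apply: (le_trans (st _)); apply: t_mono; exact: leq_maxr.
Qed.

Lemma nested_intervals_uncountable (d : Order.disp_t) (P : porderType d)
    (K : P -> P -> Prop) (s0 t0 : P) :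
  dcpo P -> (forall s t, K s t -> s <= t) -> K s0 t0 ->
  (forall s t p, K s t -> exists s' t',
    [/\ K s' t', s <= s', t' <= t & ~~ (s' <= p <= t')]) ->
  ~ countable [set: P].
Proof.
move=> dcpoP K_le K0 avoid /countable_injP[f f_inj].
(* Stage [n] discards the element coded by [n], if there is one. The premise on [K] lets [choice]
   give a total step function. *)
pose next n (I I' : P * P) := K I.1 I.2 ->
  [/\ K I'.1 I'.2, I.1 <= I'.1, I'.2 <= I.2 &
      forall p, f p = n -> ~~ (I'.1 <= p <= I'.2)].
have ex_next (nI : nat * (P * P)) : exists I', next nI.1 nI.2 I'.
  case: nI => n [s t]; have [Kst|nKst] := pselect (K s t); last by exists (s, t).
  have [[p fp]|nfp] := pselect (exists p, f p = n).
    have [s' [t' [K' ss' tt' np]]] := avoid s t p Kst.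
    exists (s', t') => _; split=> // q fq.
    by rewrite (f_inj q p) ?in_setT // fq fp.
  by exists (s, t) => _; split=> // p fp; case: nfp; exists p.
have {ex_next} [g gP] := choice ex_next.
pose I := fix I n := if n is m.+1 then g (m, I m) else (s0, t0).
have KI n : K (I n).1 (I n).2.
  by elim: n => [//|n IHn] /=; have [] := gP (n, I n) IHn.
have stepI n := gP (n, I n) (KI n).
have [|||x xI] := @nested_intervals_dcpo d P (fst \o I) (snd \o I) dcpoP.
- apply: homo_leq => [//|y x z|n]; first exact: le_trans.
  by have [] := stepI n.
- apply: homo_leq => [//|y x z yx zy|n]; first exact: le_trans zy yx.
  by have [] := stepI n.
- by move=> n; exact: K_le (KI n).
(* Stage [f x] yields the interval of index [(f x).+1], which omits [x]. *)
have [_ _ _ /(_ x erefl)] := stepI (f x).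
by rewrite (xI (f x).+1).
Qed.

Theorem proposition6p2 (d : Order.disp_t) (P : meetSemilatticeType d)
    (P_countable : countable [set: P])
    (P_dcpo : dcpo P)
    (P_mc : meet_continuous P)
    (J : set P) (J_ideal : ideal J) (J_nonprincipal : ~ principal J)
    (supJ : P) (supJP : supremums J supJ) :
  exists s t : P,
    [/\ s < t, t <= supJ & directed `[s, t[%classic] /\
    [/\ down `[s, t[%classic `<=` J, supremums `[s, t[%classic t & ~ J t].
Proof.
have nJsup : ~ J supJ.
  move=> Jsup; apply: J_nonprincipal; exists supJ; apply/seteqP; split=> x.
    exact: supJP.1.
  exact: J_ideal.2.
pose K s t := [/\ J s, ~ J t, s <= t & t <= supJ].
have [[s [t [[Js nJt st tv] min_t]]]|no_min] := pselect (exists s t, K s t /\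
    forall t', s <= t' -> t' < t -> J t').
  (* Minimality of [t] gives one inclusion, [~ J t] the other. *)
  have itvE : `[s, t[%classic = J `&` [set x | s <= x <= t].
    apply/seteqP; split=> x; rewrite /= in_itv /=.
      by move=> /andP[sx xt]; split; [exact: min_t | rewrite /= sx ltW].
    move=> [Jx /andP[sx xt]]; rewrite sx lt_neqAle xt andbT.
    by apply/eqP => xt_eq; apply: nJt; rewrite -xt_eq.
  exists s, t; rewrite itvE; split; split=> //.
  - by rewrite lt_neqAle st andbT; apply/eqP => st_eq; apply: nJt; rewrite -st_eq.
  - exact: directed_ideal_below.
  - by move=> x [y [[Jy _] xy]]; exact: J_ideal.2 Jy xy.
  - exact: (@sup_ideal_below _ _ _ supJ).
have [s0 Js0] := J_ideal.1.1.
exfalso; apply: (@nested_intervals_uncountable d P K s0 supJ) P_countable => //.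
- by move=> s t [].
- by split=> //; exact: supJP.1.
move=> s t p Kst; have [Js nJt st tv] := Kst.
have [/andP[sp pt]|np] := boolP (s <= p <= t); last by exists s, t.
have [Jp|nJp] := pselect (J p).
  (* Otherwise [p] bounds a set with supremum [t], so [t <= p] would lie in [J]. *)
  have [x [[Jx /andP[sx xt]] nxp]] :
      exists x, (J `&` [set x | s <= x <= t]) x /\ ~~ (x <= p).
    apply: contrapT => all_le; apply: nJt; apply: J_ideal.2 Jp _.
    apply: (@sup_ideal_below _ _ _ _ _ _ P_mc J_ideal supJP Js st tv).2 => x Jx.
    by apply: contrapT => /negP nxp; apply: all_le; exists x.
  by exists x, t; rewrite (negbTE nxp).
(* Otherwise [s] and [p] would be the pair excluded by [no_min]. *)
have [t' [st' t'p nJt']] : exists t', [/\ s <= t', t' < p & ~ J t'].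
  apply: contrapT => min_p; apply: no_min; exists s, p.
  split=> [|t' st' t'p]; first by split=> //; exact: le_trans pt tv.
  by apply: contrapT => nJt'; apply: min_p; exists t'.
have t't := le_trans (ltW t'p) pt.
exists s, t'; split=> //; first by split=> //; exact: le_trans t't tv.
by rewrite (lt_geF t'p) andbF.
Qed.
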